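(* Let $F$ be an arbitrary finite group acting (on the right, by automorphisms, via $\lhd$) on a finite abelian group $V$ of odd order, and let $k$ be a field. Suppose that $(k^\times)^n=k^\times$, where $n$ is the exponent of $V$. Then $$\operatorname{Opext}_{\lhd}(kF,k^V)\cong H^2(F,\widehat{V})\oplus\operatorname{Der}(F,\wedge^2\widehat{V}),$$ where $\widehat{V}=\operatorname{Hom}(V,k^\times)$.
   Context: $F$ acts on the left on $\widehat{V}$ by $(x\cdot\psi)(v)=\psi(v\lhd x)$, and on $\wedge^2\widehat{V}$ (exterior square over $\mathbb{Z}$, identified with the group of alternating bicharacters $V\times V\to k^\times$) by the induced action. $\operatorname{Der}(F,M)$ is the group of maps $d:F\to M$ with $d(xy)=d(x)+x\cdot d(y)$. $\operatorname{Opext}_\lhd(kF,k^V)$ is defined as follows. Consider pairs $(\sigma,\tau)$ of maps $\sigma:V\times F\times F\to k^\times$, $\tau:V\times V\times F\to k^\times$ that are normalized ($\sigma(s;x,y)=1$ if $x=e$ or $y=e$; $\tau(s,t;x)=1$ if $s=e$ or $t=e$) and satisfy, for all $s,t,r\in V$, $x,y,z\in F$ (groups written multiplicatively), $$\sigma(s\lhd x;y,z)\sigma(s;x,yz)=\sigma(s;x,y)\sigma(s;xy,z),\qquad \tau(st,r;x)\tau(s,t;x)=\tau(s,tr;x)\tau(t,r;x),$$ $$\sigma(st;x,y)\tau(s,t;xy)=\sigma(s;x,y)\sigma(t;x,y)\tau(s,t;x)\tau(s\lhd x,t\lhd x;y).$$ Such a pair defines a Hopf algebra $k^V\#_{\sigma,\tau}kF$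 with basis $\{e_s\#x\}$, product $(e_s\#x)(e_t\#y)=\delta_{s\lhd x,t}\sigma(s;x,y)e_s\#xy$, coproduct $\Delta(e_s\#x)=\sum_{ab=s}\tau(a,b;x)e_a\#x\otimes e_b\#x$, and an extension $k\to k^V\to k^V\#_{\sigma,\tau}kF\to kF\to k$ with maps $e_s\mapsto e_s\#e$ and $e_s\#x\mapsto\delta_{s,e}x$. Two extensions are equivalent if there is a Hopf algebra homomorphism between the middle terms commuting with the maps from $k^V$ and to $kF$. $\operatorname{Opext}_{\lhd}(kF,k^V)$ is the abelian group of equivalence classes, with the Baer product (induced by pointwise multiplication of pairs $(\sigma,\tau)$). *)

(* Defs.v *)
From HB Require Import structures.
From mathcomp Require Import all_boot all_order all_algebra all_fingroup all_solvable.
From mathcomp Require Import boolp.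

Set Implicit Arguments.
Unset Strict Implicit.
Unset Printing Implicit Defensive.

Import GRing.Theory.
Local Open Scope ring_scope.
Local Open Scope quotient_scope.

(* The group k^*, written ADDITIVELY so that zmodType constructions (finite
   functions, subgroups, quotients, products) apply: in [kunits k], [a + b] is
   the product of k, [0] is the unit 1 of k and [- a] is the inverse. *)
Record kunits (k : fieldType) := KUnit { kval :> k; kvalP : kval != 0 }.

HB.instance Definition _ (k : fieldType) := [isSub for @kval k].
HB.instance Definition _ (k : fieldType) := [Choice of kunits k by <:].

Section Units.
Variable k : fieldType.
Implicit Types a b c : kunits k.

Definition kone : kunits k := KUnit (oner_neq0 k).
Definition kmul a b : kunits k := KUnit (mulf_neq0 (kvalP a) (kvalP b)).

Fact kinv_subproof a : (kval a)^-1 != 0.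
Proof. by rewrite invr_eq0 kvalP. Qed.
Definition kinv a : kunits k := KUnit (kinv_subproof a).

Fact kmulA : associative kmul.
Proof. by move=> a b c; apply/val_inj/mulrA. Qed.
Fact kmulC : commutative kmul.
Proof. by move=> a b; apply/val_inj/mulrC. Qed.
Fact kmul1 : left_id kone kmul.
Proof. by move=> a; apply/val_inj/mul1r. Qed.
Fact kmulV : left_inverse kone kinv kmul.
Proof. by move=> a; apply/val_inj/mulVf/kvalP. Qed.

HB.instance Definition _ := GRing.isZmodule.Build (kunits k) kmulA kmulC kmul1 kmulV.

Lemma kval0 : kval (0 : kunits k) = 1. Proof. by []. Qed.
Lemma kvalD a b : kval (a + b) = kval a * kval b. Proof. by []. Qed.
Lemma kvalN a : kval (- a) = (kval a)^-1. Proof. by []. Qed.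

End Units.

Section GroupCohomology.
Variables (F : finGroupType) (M : zmodType).

Record gmodule := GModule {
  gmod_act :> F -> {additive M -> M};
  gmod_act1 : forall m, gmod_act 1%g m = m;
  gmod_actM : forall x y m, gmod_act (x * y)%g m = gmod_act x (gmod_act y m) }.

Variable A : gmodule.

Definition is_cocycle2 (f : {ffun F * F -> M}) : Prop :=
  forall x y z, A x (f (y, z)) + f (x, (y * z)%g) = f ((x * y)%g, z) + f (x, y).

Definition cocycle2_pred : {pred {ffun F * F -> M}} := fun f => `[< is_cocycle2 f >].

Fact cocycle2_closed : zmod_closed cocycle2_pred.
Proof.
split=> [|f g /asboolP fP /asboolP gP]; apply/asboolP => x y z.
  by rewrite !ffunE raddf0.
by rewrite !ffunE raddfB addrACA -opprD fP gP opprD addrACA.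
Qed.
HB.instance Definition _ :=
  GRing.isZmodClosed.Build {ffun F * F -> M} cocycle2_pred cocycle2_closed.

Record cocycle2 := Cocycle2 {
  cocycle2_val :> {ffun F * F -> M}; _ : cocycle2_val \in cocycle2_pred }.
HB.instance Definition _ := [isSub for cocycle2_val].
HB.instance Definition _ := [Choice of cocycle2 by <:].
HB.instance Definition _ := [SubChoice_isSubZmodule of cocycle2 by <:].

Definition is_coboundary2 (f : cocycle2) : Prop :=
  exists h : {ffun F -> M}, forall x y, f (x, y) = A x (h y) - h (x * y)%g + h x.

Definition coboundary2_pred : {pred cocycle2} := fun f => `[< is_coboundary2 f >].

Fact coboundary2_closed : zmod_closed coboundary2_pred.
Proof.
split=> [|f g /asboolP[h hP] /asboolP[h' h'P]]; apply/asboolP.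
  by exists 0 => x y; rewrite !ffunE raddf0 subrr addr0.
exists (h - h') => x y; rewrite /= !ffunE hP h'P raddfB.
by rewrite !opprD !opprK addrACA; congr (_ + _); rewrite addrACA.
Qed.
HB.instance Definition _ :=
  GRing.isZmodClosed.Build cocycle2 coboundary2_pred coboundary2_closed.

Definition H2 := {ideal_quot coboundary2_pred}.
HB.instance Definition _ := GRing.Zmodule.on H2.

Definition is_der (d : {ffun F -> M}) : Prop :=
  forall x y, d (x * y)%g = d x + A x (d y).

Definition der_pred : {pred {ffun F -> M}} := fun d => `[< is_der d >].

Fact der_closed : zmod_closed der_pred.
Proof.
split=> [|d e /asboolP dP /asboolP eP]; apply/asboolP => x y.
  by rewrite !ffunE raddf0 addr0.
by rewrite !ffunE dP eP raddfB opprD addrACA.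
Qed.
HB.instance Definition _ :=
  GRing.isZmodClosed.Build {ffun F -> M} der_pred der_closed.

Record Der := MkDer { der_val :> {ffun F -> M}; _ : der_val \in der_pred }.
HB.instance Definition _ := [isSub for der_val].
HB.instance Definition _ := [Choice of Der by <:].
HB.instance Definition _ := [SubChoice_isSubZmodule of Der by <:].

End GroupCohomology.

Section Characters.
Variables (k : fieldType) (F V : finGroupType).
Variable act : groupAction [set: F] [set: V].

Lemma ract1 s : act s 1%g = s. Proof. exact: act1. Qed.
Lemma ractM s x y : act s (x * y)%g = act (act s x) y.
Proof. by rewrite actMin ?inE. Qed.
Lemma ract_morph s t x : act (s * t)%g x = (act s x * act t x)%g.
Proof. by apply: gactM; rewrite inE. Qed.

Definition is_char (c : {ffun V -> kunits k}) : Prop :=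
  forall s t, c (s * t)%g = c s + c t.

Definition char_pred : {pred {ffun V -> kunits k}} := fun c => `[< is_char c >].

Fact char_closed : zmod_closed char_pred.
Proof.
split=> [|c d /asboolP cP /asboolP dP]; apply/asboolP => s t.
  by rewrite !ffunE addr0.
by rewrite !ffunE cP dP opprD addrACA.
Qed.
HB.instance Definition _ :=
  GRing.isZmodClosed.Build {ffun V -> kunits k} char_pred char_closed.

Record dual := Dual { dual_val :> {ffun V -> kunits k}; dualP : dual_val \in char_pred }.
HB.instance Definition _ := [isSub for dual_val].
HB.instance Definition _ := [Choice of dual by <:].
HB.instance Definition _ := [SubChoice_isSubZmodule of dual by <:].

Fact dual_act_subproof x (c : dual) : [ffun v => c (act v x)] \in char_pred.
Proof.
by apply/asboolP => s t; rewrite !ffunE ract_morph; apply: (asboolW (dualP c)).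
Qed.
Definition dual_act x (c : dual) : dual := Dual (dual_act_subproof x c).

Fact dual_act_additive x : zmod_morphism (dual_act x).
Proof. by move=> c d; apply/val_inj/ffunP => v; rewrite !ffunE. Qed.
HB.instance Definition _ x :=
  GRing.isZmodMorphism.Build dual dual (dual_act x) (dual_act_additive x).

Fact dual_act1 c : dual_act 1%g c = c.
Proof. by apply/val_inj/ffunP => v; rewrite ffunE ract1. Qed.
Fact dual_actM x y c : dual_act (x * y)%g c = dual_act x (dual_act y c).
Proof. by apply/val_inj/ffunP => v; rewrite !ffunE ractM. Qed.

Definition dual_gmod : gmodule F dual :=
  @GModule F dual (fun x => dual_act x : {additive dual -> dual})
    dual_act1 dual_actM.

(* The exterior square of the dual of V, as the group of alternating
   bicharacters of V: c /\ d is the bicharacter (s, t) |-> c(s)d(t)/(c(t)d(s)). *)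
Definition is_altbichar (b : {ffun V * V -> kunits k}) : Prop :=
  [/\ forall s t r, b ((s * t)%g, r) = b (s, r) + b (t, r),
      forall s t r, b (s, (t * r)%g) = b (s, t) + b (s, r)
    & forall s, b (s, s) = 0].

Definition altbichar_pred : {pred {ffun V * V -> kunits k}} :=
  fun b => `[< is_altbichar b >].

Fact altbichar_closed : zmod_closed altbichar_pred.
Proof.
split=> [|b c /asboolP[b1 b2 b3] /asboolP[c1 c2 c3]]; apply/asboolP.
  by split=> *; rewrite !ffunE ?addr0.
by split=> *; rewrite !ffunE ?(b1, b2, b3) ?(c1, c2, c3) ?subrr // opprD addrACA.
Qed.
HB.instance Definition _ :=
  GRing.isZmodClosed.Build {ffun V * V -> kunits k} altbichar_pred altbichar_closed.

Record ext2dual := Ext2Dual {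
  ext2_val :> {ffun V * V -> kunits k}; ext2P : ext2_val \in altbichar_pred }.
HB.instance Definition _ := [isSub for ext2_val].
HB.instance Definition _ := [Choice of ext2dual by <:].
HB.instance Definition _ := [SubChoice_isSubZmodule of ext2dual by <:].

Fact ext2_act_subproof x (b : ext2dual) :
  [ffun p : V * V => b (act p.1 x, act p.2 x)] \in altbichar_pred.
Proof.
have [b1 b2 b3] := asboolW (ext2P b).
by apply/asboolP; split=> *; rewrite !ffunE /= ?ract_morph.
Qed.
Definition ext2_act x (b : ext2dual) : ext2dual := Ext2Dual (ext2_act_subproof x b).

Fact ext2_act_additive x : zmod_morphism (ext2_act x).
Proof. by move=> b c; apply/val_inj/ffunP => v; rewrite !ffunE. Qed.
HB.instance Definition _ x :=
  GRing.isZmodMorphism.Build ext2dual ext2dual (ext2_act x) (ext2_act_additive x).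

Fact ext2_act1 b : ext2_act 1%g b = b.
Proof. by apply/val_inj/ffunP => -[s t]; rewrite ffunE /= !ract1. Qed.
Fact ext2_actM x y b : ext2_act (x * y)%g b = ext2_act x (ext2_act y b).
Proof. by apply/val_inj/ffunP => -[s t]; rewrite !ffunE /= !ractM. Qed.

Definition ext2_gmod : gmodule F ext2dual :=
  @GModule F ext2dual (fun x => ext2_act x : {additive ext2dual -> ext2dual})
    ext2_act1 ext2_actM.

End Characters.

(* [{ffun I -> k^o}] is the free k-module on I; the tensor square of the free
   module on I is the free module on I * I. *)
Section FreeModules.
Variable k : fieldType.

Definition basis (I : finType) (i : I) : {ffun I -> k^o} := [ffun j => (j == i)%:R].

Definition lin_ext (I : finType) (W : lmodType k) (g : I -> W) (u : {ffun I -> k^o}) : W :=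
  \sum_i (u i : k) *: g i.

Definition tensor (I J : finType) (u : {ffun I -> k^o}) (v : {ffun J -> k^o}) :
  {ffun I * J -> k^o} := [ffun p => u p.1 * v p.2].

Definition tensor_map (I J I' J' : finType)
    (f : {ffun I -> k^o} -> {ffun I' -> k^o}) (g : {ffun J -> k^o} -> {ffun J' -> k^o}) :
    {ffun I * J -> k^o} -> {ffun I' * J' -> k^o} :=
  lin_ext (fun p => tensor (f (basis p.1)) (g (basis p.2))).

Record bialg_ops (I : finType) := BialgOps {
  bmul : {ffun I -> k^o} -> {ffun I -> k^o} -> {ffun I -> k^o};
  bone : {ffun I -> k^o};
  bcomul : {ffun I -> k^o} -> {ffun I * I -> k^o};
  bcounit : {ffun I -> k^o} -> k }.

(* A Hopf algebra homomorphism is a bialgebra homomorphism; compatibility with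
   the antipodes is automatic. *)
Record hopf_hom (I J : finType) (A : bialg_ops I) (B : bialg_ops J)
    (f : {linear {ffun I -> k^o} -> {ffun J -> k^o}}) : Prop := HopfHom {
  hopf_homM : forall u v, f (bmul A u v) = bmul B (f u) (f v);
  hopf_hom1 : f (bone A) = bone B;
  hopf_homD : forall u, bcomul B (f u) = tensor_map f f (bcomul A u);
  hopf_homE : forall u, bcounit B (f u) = bcounit A u }.

End FreeModules.

Section Opext.
Variables (k : fieldType) (F V : finGroupType).
Variable act : groupAction [set: F] [set: V].

Definition extpairs : zmodType :=
  ({ffun V * F * F -> kunits k} * {ffun V * V * F -> kunits k})%type.

(* A pair (sigma, tau): [p.1 (s, x, y)] is sigma(s; x, y) and [p.2 (s, t, x)] is
   tau(s, t; x), with values in the additively written k^*. *)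
Record is_extdatum (p : extpairs) : Prop := IsExtdatum {
  extd_sigma1 : forall s x, p.1 (s, 1%g, x) = 0;
  extd_sigma2 : forall s x, p.1 (s, x, 1%g) = 0;
  extd_tau1 : forall s x, p.2 (1%g, s, x) = 0;
  extd_tau2 : forall s x, p.2 (s, 1%g, x) = 0;
  extd_sigma : forall s x y z,
    p.1 (act s x, y, z) + p.1 (s, x, (y * z)%g) = p.1 (s, x, y) + p.1 (s, (x * y)%g, z);
  extd_tau : forall s t r x,
    p.2 ((s * t)%g, r, x) + p.2 (s, t, x) = p.2 (s, (t * r)%g, x) + p.2 (t, r, x);
  extd_compat : forall s t x y,
    p.1 ((s * t)%g, x, y) + p.2 (s, t, (x * y)%g) =
    p.1 (s, x, y) + p.1 (t, x, y) + p.2 (s, t, x) + p.2 (act s x, act t x, y) }.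

Definition extdatum_pred : {pred extpairs} := fun p => `[< is_extdatum p >].

Fact extdatum_closed : zmod_closed extdatum_pred.
Proof.
split=> [|p q /asboolP[p1 p2 p3 p4 p5 p6 p7] /asboolP[q1 q2 q3 q4 q5 q6 q7]].
  by apply/asboolP; split=> *; rewrite !ffunE ?addr0.
apply/asboolP; split=> *; rewrite !ffunE.
- by rewrite p1 q1 subrr.
- by rewrite p2 q2 subrr.
- by rewrite p3 q3 subrr.
- by rewrite p4 q4 subrr.
- by rewrite addrACA -opprD p5 q5 opprD addrACA.
- by rewrite addrACA -opprD p6 q6 opprD addrACA.
- rewrite addrACA -opprD p7 q7 !opprD addrACA; congr (_ + _).
  by rewrite addrACA; congr (_ + _); rewrite addrACA.
Qed.
HB.instance Definition _ :=
  GRing.isZmodClosed.Build extpairs extdatum_pred extdatum_closed.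

Record extdatum := Extdatum { extd_val :> extpairs; extdP : extd_val \in extdatum_pred }.
HB.instance Definition _ := [isSub for extd_val].
HB.instance Definition _ := [Choice of extdatum by <:].
HB.instance Definition _ := [SubChoice_isSubZmodule of extdatum by <:].

Definition sigma (p : extdatum) (s : V) (x y : F) : k := kval ((extd_val p).1 (s, x, y)).
Definition tau (p : extdatum) (s t : V) (x : F) : k := kval ((extd_val p).2 (s, t, x)).

Local Notation H := {ffun V * F -> k^o}.

(* The basis vector e_s # x. *)
Definition smb (s : V) (x : F) : H := basis k (s, x).

Definition smash_mul (p : extdatum) (u v : H) : H :=
  \sum_(a : V * F) \sum_(b : V * F) ((u a : k) * v b) *:
    (if act a.1 a.2 == b.1 then sigma p a.1 a.2 b.2 *: smb a.1 (a.2 * b.2)%g else 0).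

Definition smash_comul (p : extdatum) : H -> {ffun (V * F) * (V * F) -> k^o} :=
  lin_ext (fun c : V * F =>
    \sum_(ab : V * V | (ab.1 * ab.2)%g == c.1)
      tau p ab.1 ab.2 c.2 *: tensor (smb ab.1 c.2) (smb ab.2 c.2)).

Definition smash (p : extdatum) : bialg_ops k (V * F)%type := {|
  bmul := smash_mul p;
  bone := \sum_s smb s 1%g;
  bcomul := smash_comul p;
  bcounit := fun u => \sum_x u (1%g, x) |}.

Definition smash_inj : {ffun V -> k^o} -> H := lin_ext (fun s => smb s 1%g).
Definition smash_proj : H -> {ffun F -> k^o} :=
  lin_ext (fun c : V * F => if c.1 == 1%g then basis k c.2 else 0).

Definition ext_equiv (p q : extdatum) : Prop :=
  exists f : {linear H -> H},
    [/\ hopf_hom (smash p) (smash q) f,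
        forall u, f (smash_inj u) = smash_inj u
      & forall u, smash_proj (f u) = smash_proj u].

End Opext.

Section OpextGroup.
Variables (k : fieldType) (F V : finGroupType).
Variable act : groupAction [set: F] [set: V].
Local Notation H := {ffun V * F -> k^o}.
Local Notation extdatum := (extdatum k act).
Implicit Types (p q r : extdatum) (u v : H) (s t : V) (x y : F).

Fact scalekE (a b : k) : a *: (b : k^o) = a * b. Proof. by []. Qed.

Lemma lin_extE (I J : finType) (g : I -> {ffun J -> k^o}) (u : {ffun I -> k^o}) j :
  lin_ext g u j = \sum_i (u i : k) * g i j.
Proof. by rewrite /lin_ext sum_ffunE; apply: eq_bigr => i _; rewrite ffunE. Qed.

Lemma smash_mulE p u v s z :
  smash_mul p u v (s, z) =
  \sum_x (u (s, x) : k) * v (act s x, x^-1 * z)%g * sigma p s x (x^-1 * z)%g.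
Proof.
rewrite /smash_mul sum_ffunE (eq_bigr (fun a : V * F =>
  if a.1 == s then (u (s, a.2) : k) * v (act s a.2, a.2^-1 * z)%g
                     * sigma p s a.2 (a.2^-1 * z)%g else 0)); last first.
  case=> t x _ /=; rewrite sum_ffunE.
  rewrite (bigD1 (act t x, x^-1 * z)%g) //= big1 ?addr0; last first.
    case=> t' y /= ne; rewrite ffunE; move: ne.
    case: (act t x =P t') => [<- ne|_ _]; last by rewrite ffunE scaler0.
    rewrite !ffunE xpair_eqE /=; case: (altP (z =P _)) => [zE|_]; last first.
      by rewrite andbF !scaler0.
    by rewrite zE mulKg eqxx in ne.
  rewrite eqxx !ffunE xpair_eqE mulKVg eqxx andbT eq_sym !scalekE.
  by case: (altP eqP) => [->|_]; rewrite ?mulr1 ?mulr0.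
rewrite -(pair_bigA _ (fun t x => if t == s then (u (s, x) : k) *
   v (act s x, x^-1 * z)%g * sigma p s x (x^-1 * z)%g else 0)) /=.
rewrite (bigD1 s) //= eqxx [X in _ + X]big1 ?addr0 // => t /negPf ts.
by rewrite ts big1.
Qed.

Lemma smash_comulE p u a x b y :
  smash_comul p u ((a, x), (b, y)) =
  if x == y then (u (a * b, x)%g : k) * tau p a b x else 0.
Proof.
rewrite /smash_comul lin_extE (eq_bigr (fun c : V * F =>
  if c == (a * b, x)%g then (if x == y then (u (a * b, x)%g : k) * tau p a b x else 0)
  else 0)).
  by rewrite -big_mkcond big_pred1_eq.
case=> s z _ /=; rewrite sum_ffunE; rewrite xpair_eqE.
rewrite (eq_bigr (fun i : V * V => if i == (a, b) then
  (if (x == z) && (y == z) then tau p a b z else 0) else 0)); last first.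
  case=> a' b' _; rewrite !ffunE /= !xpair_eqE scalekE (eq_sym a) (eq_sym b).
  case: (a' =P a) => [->|_] /=; last by rewrite mul0r mulr0.
  case: (b' =P b) => [->|_] /=; last by rewrite mulr0 mulr0.
  by rewrite -natrM mulnb; case: andP => _; rewrite (mulr1, mulr0).
rewrite -big_mkcondr /=; case: (altP (s =P _)) => [->|ne] /=; last first.
  rewrite big_pred0 ?mulr0 // => -[a' b'] /=; apply/negP => /andP[/eqP sE].
  by case/eqP=> ea eb; rewrite -sE ea eb eqxx in ne.
rewrite (big_pred1 (a, b)) => [|-[a' b'] /=]; last first.
  by case: ((a', b') =P (a, b)) => [[-> ->]|_]; rewrite ?eqxx ?andbF.
rewrite (eq_sym x z); case: (z =P x) => [->|_] /=; last by rewrite mulr0.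
by rewrite (eq_sym y); case: eqP => _; rewrite ?mulr0.
Qed.

Lemma smash_injE (u : {ffun V -> k^o}) s x :
  smash_inj F u (s, x) = if x == 1%g then u s else 0.
Proof.
rewrite /smash_inj lin_extE (bigD1 s) //= big1 => [|t ts]; rewrite !ffunE xpair_eqE.
  by rewrite eqxx addr0 /=; case: eqP => _; rewrite (mulr1, mulr0).
by rewrite eq_sym (negPf ts) mulr0.
Qed.

Lemma smash_projE u x : smash_proj u x = u (1%g, x).
Proof.
rewrite /smash_proj lin_extE (bigD1 (1%g, x)) //= big1 => [|[t y] /= ty].
  by rewrite eqxx ffunE eqxx mulr1 addr0.
case: eqP => [t1|_]; rewrite ffunE ?mulr0 //.
case: eqP => [yx|_]; rewrite ?mulr0 //.
by rewrite t1 yx eqxx in ty.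
Qed.

Lemma smash_oneE (s : V) (x : F) : (\sum_(t : V) smb k t (1%g : F)) (s, x) = (x == 1%g)%:R :> k.
Proof.
rewrite sum_ffunE (bigD1 s) //= big1 => [|t ts]; rewrite !ffunE xpair_eqE.
  by rewrite eqxx addr0.
by rewrite eq_sym (negPf ts).
Qed.

Lemma smash_inj_basis (s : V) : smash_inj F (basis k s) = smb k s (1%g : F).
Proof.
apply/ffunP => -[t x]; rewrite smash_injE !ffunE xpair_eqE.
by case: (x == _); rewrite ?andbT ?andbF.
Qed.

(* Equivalences of extensions rescale the basis vectors. *)
Definition rescaling p q (l : {ffun V * F -> kunits k}) : Prop :=
  (forall s x y, l (s, x) + l (act s x, y) + (extd_val q).1 (s, x, y)
                 = l (s, (x * y)%g) + (extd_val p).1 (s, x, y)) /\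
  (forall s t x, l ((s * t)%g, x) + (extd_val q).2 (s, t, x)
                 = l (s, x) + l (t, x) + (extd_val p).2 (s, t, x)).

Definition rescale (l : {ffun V * F -> kunits k}) u : H :=
  [ffun c => kval (l c) * (u c : k)].

Fact rescale_linear l : linear (rescale l).
Proof.
move=> a u v; apply/ffunP => c; rewrite !ffunE mulrDr; congr (_ + _).
by rewrite mulrCA.
Qed.
HB.instance Definition _ l :=
  GRing.isLinear.Build k H H *:%R (rescale l) (rescale_linear l).

Lemma rescaleE l c : rescale l (basis k c) = (kval (l c) : k) *: basis k c.
Proof.
apply/ffunP => d; rewrite !ffunE; rewrite scalekE.
by case: (d =P c) => [->|_]; rewrite ?mulr0.
Qed.

Lemma tensor_rescaleE l w c d :
  tensor_map (rescale l) (rescale l) w (c, d) = kval (l c) * kval (l d) * (w (c, d) : k).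
Proof.
rewrite /tensor_map lin_extE (bigD1 (c, d)) //= big1 ?addr0 => [|[c' d'] ne].
  by rewrite !ffunE /= !eqxx !mulr1 mulrC.
rewrite !rescaleE !ffunE /=; move: ne; rewrite xpair_eqE negb_and.
by rewrite (eq_sym c') (eq_sym d'); case/orP=> /negPf->; rewrite !scalekE ?(mulr0, mul0r).
Qed.

Lemma extdP2 p : is_extdatum act p. Proof. exact: asboolW (extdP p). Qed.

Lemma rescaling1 p q l : rescaling p q l ->
  (forall s, l (s, 1%g) = 0) /\ (forall x, l (1%g, x) = 0).
Proof.
case=> l1 l2; split=> [s|x].
  have := l1 s 1%g 1%g; rewrite mulg1 ract1 !(extd_sigma2 (extdP2 _)) !addr0.
  by move/(canRL (addrK _)); rewrite subrr.
have := l2 1%g 1%g x; rewrite mulg1 !(extd_tau1 (extdP2 _)) !addr0.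
by move/esym/(canRL (addrK _)); rewrite subrr.
Qed.

Lemma rescaling_equiv p q l : rescaling p q l -> ext_equiv p q.
Proof.
move=> lP; have [ls1 l1x] := rescaling1 lP; case: lP => l1 l2.
exists (rescale l); split; first split=> [u v||u|u].
- apply/ffunP => -[s z]; rewrite ffunE /= !smash_mulE mulr_sumr.
  apply: eq_bigr => x _; rewrite !ffunE /sigma.
  have /(congr1 (@kval k)) := l1 s x (x^-1 * z)%g; rewrite mulKVg !kvalD => E.
  rewrite [RHS](_ : _ = (kval (l (s, x)) * kval (l (act s x, x^-1 * z)%g)
     * kval ((extd_val q).1 (s, x, (x^-1 * z)%g))) *
     ((u (s, x) : k) * v (act s x, x^-1 * z)%g)).
    by rewrite E mulrA mulrAC mulrCA !mulrA.
  by rewrite mulrACA -!mulrA; do 2!congr (_ * _); rewrite mulrA mulrC mulrA.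
- by apply/ffunP => -[s x]; rewrite ffunE /= smash_oneE; case: eqP => [->|_];
  rewrite ?mulr0 // ls1 mul1r.
- apply/ffunP => -[[a x] [b y]]; rewrite tensor_rescaleE /= !smash_comulE.
  case: eqP => [<-|_]; last by rewrite mulr0.
  rewrite ffunE /tau; have /(congr1 (@kval k)) := l2 a b x; rewrite !kvalD => E.
  by rewrite mulrAC E mulrAC mulrA.
- by rewrite /=; apply: eq_bigr => x _; rewrite ffunE l1x mul1r.
- move=> u; apply/ffunP => -[s x]; rewrite ffunE smash_injE.
  by case: eqP => [->|_]; rewrite ?mulr0 // ls1 mul1r.
- by move=> u; apply/ffunP => x; rewrite !smash_projE ffunE l1x mul1r.
Qed.

Lemma smash_mul_eps p s u t x :
  smash_mul p (smb k s 1%g) u (t, x) = if t == s then u (s, x) else 0.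
Proof.
rewrite smash_mulE (bigD1 1%g) //= big1 => [|y y1]; rewrite !ffunE xpair_eqE.
  rewrite eqxx andbT ract1 invg1 mul1g addr0.
  case: (t =P s) => [->|_]; last by rewrite !mul0r.
  by rewrite mul1r /sigma (extd_sigma1 (extdP2 _)) kval0 mulr1.
by rewrite (negPf y1) andbF !mul0r.
Qed.

Lemma smash_mul_basis p s x y :
  smash_mul p (smb k s x) (smb k (act s x) y) = sigma p s x y *: smb k s (x * y)%g.
Proof.
apply/ffunP => -[t z]; rewrite smash_mulE !ffunE scalekE xpair_eqE.
rewrite (bigD1 x) //= big1 => [|x' x'x]; rewrite !ffunE !xpair_eqE; last first.
  by rewrite (negPf x'x) andbF !mul0r.
rewrite eqxx andbT addr0; case: (t =P s) => [->|_]; last by rewrite !mul0r mulr0.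
rewrite eqxx mul1r /= (canF_eq (mulKVg x)) mulrC.
by case: (z =P _) => [->|_]; rewrite ?mulKg ?mulr0.
Qed.

Lemma equiv_rescaling p q : ext_equiv p q -> exists l, rescaling p q l.
Proof.
case=> f [[fM f1 fD fE] fi fp].
pose c s x : k := f (smb k s x) (s, x).
have supp1 s x t y : f (smb k s x) (t, y) = if t == s then f (smb k s x) (s, y) else 0.
  have E : smb k s x = smash_mul p (smb k s 1%g) (smb k s x).
    have := smash_mul_basis p s 1%g x.
    by rewrite ract1 mul1g /sigma (extd_sigma1 (extdP2 _)) kval0 scale1r => ->.
  by rewrite [in LHS]E (fM : forall u v, f (smash_mul p u v) = smash_mul q (f u) (f v))
     -[in smb k s 1%g]smash_inj_basis fi smash_inj_basis smash_mul_eps.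
have proj1 x y : f (smb k 1%g x) (1%g, y) = (y == x)%:R.
  have := congr1 (fun w : {ffun F -> k^o} => w y) (fp (smb k 1%g x)).
  by rewrite !smash_projE => ->; rewrite ffunE xpair_eqE eqxx.
have comulE s x a y b z : smash_comul q (f (smb k s x)) ((a, y), (b, z)) =
    if s == (a * b)%g then tau p a b x * f (smb k a x) (a, y) * f (smb k b x) (b, z) else 0.
  rewrite (fD : forall u, smash_comul q (f u) = tensor_map f f (smash_comul p u)).
  rewrite /tensor_map lin_extE (bigD1 ((a, x), (b, x))) //= big1 ?addr0.
    rewrite smash_comulE eqxx !ffunE xpair_eqE eqxx andbT eq_sym /=.
    by case: eqP => _; rewrite ?mul0r // mul1r mulrA.
  case=> -[a' y'] [b' z'] /= ne; rewrite smash_comulE; move: ne.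
  case: (y' =P z') => [<- ne|_ _]; last by rewrite mul0r.
  rewrite !ffunE !xpair_eqE /=; case: (y' =P x) ne => [-> ne|_ _]; last first.
    by rewrite andbF !mul0r.
  rewrite (supp1 a') (supp1 b'); case: (a =P a') ne => [<- ne|_ _]; last first.
    by rewrite mul0r mulr0.
  case: (b =P b') ne => [<- ne|_ _]; last by rewrite !mulr0.
  by rewrite eqxx in ne.
have fE' s x : f (smb k s x) = c s x *: smb k s x.
  apply/ffunP => -[t y]; rewrite supp1 !ffunE scalekE xpair_eqE.
  case: (t =P s) => [_|_]; last by rewrite mulr0.
  have := comulE s x s y 1%g y; rewrite smash_comulE eqxx mulg1 eqxx proj1 /tau.
  rewrite !(extd_tau2 (extdP2 _)) kval0 mul1r mulr1 => ->.
  by rewrite /=; case: (y =P x) => [->|_]; rewrite ?mulr0.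
have c1 s : c s 1%g = 1.
  by rewrite /c -smash_inj_basis fi smash_inj_basis ffunE eqxx.
have cM s x y : c s x * c (act s x) y * sigma q s x y = c s (x * y)%g * sigma p s x y.
  have := fM (smb k s x) (smb k (act s x) y).
  rewrite /= smash_mul_basis linearZ /= !fE'.
  move/(congr1 (fun w : H => w (s, (x * y)%g))).
  rewrite smash_mulE !ffunE !scalekE eqxx mulr1 [LHS]mulrC => ->.
  rewrite (bigD1 x) //= big1 => [|z zx]; rewrite !ffunE !xpair_eqE !scalekE.
    by rewrite mulKg !eqxx !mulr1 addr0.
  by rewrite (negPf zx) andbF mulr0 !mul0r.
have cD s t x : c (s * t)%g x * tau q s t x = c s x * c t x * tau p s t x.
  have := comulE (s * t)%g x s x t x; rewrite smash_comulE !eqxx => ->.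
  by rewrite [RHS]mulrC mulrA.
have c_neq0 s x : c s x != 0.
  have := cM s x x^-1%g; rewrite mulgV c1 mul1r => E.
  have : sigma p s x x^-1%g != 0 by apply: kvalP.
  by rewrite -E; apply: contraNneq => ->; rewrite !mul0r.
exists [ffun a => KUnit (c_neq0 a.1 a.2)].
by split=> *; apply/val_inj; rewrite !ffunE ?[RHS]kvalD; [apply: cM|apply: cD].
Qed.

Lemma ext_equivP p q : ext_equiv p q <-> exists l, rescaling p q l.
Proof.
by split=> [/equiv_rescaling//|[l]]; apply: rescaling_equiv.
Qed.

Lemma rescaling_refl p : rescaling p p 0.
Proof. by split=> *; rewrite !ffunE !addr0. Qed.

Lemma rescalingB p q l p' q' l' :
  rescaling p q l -> rescaling p' q' l' -> rescaling (p - p') (q - q') (l - l').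
Proof.
case=> l1 l2 [l1' l2']; split=> [s x y|s t x]; rewrite !ffunE.
  by rewrite [X in X + _]addrACA -opprD addrACA -opprD l1 l1' opprD addrACA.
rewrite [LHS]addrACA -opprD l2 l2' [X in _ = X + _]addrACA.
by rewrite [RHS]addrACA !opprD.
Qed.

Lemma ext_equivB p q p' q' :
  ext_equiv p q -> ext_equiv p' q' -> ext_equiv (p - p') (q - q').
Proof.
move=> /ext_equivP[l lP] /ext_equivP[l' l'P]; apply/ext_equivP.
by exists (l - l'); apply: rescalingB.
Qed.

Lemma ext_equiv_refl p : ext_equiv p p.
Proof. by apply/ext_equivP; exists 0; apply: rescaling_refl. Qed.

Lemma ext_equivN p q : ext_equiv p q -> ext_equiv (- p) (- q).
Proof. by move/(ext_equivB (ext_equiv_refl 0)); rewrite !sub0r. Qed.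

Lemma ext_equivD p q p' q' :
  ext_equiv p q -> ext_equiv p' q' -> ext_equiv (p + p') (q + q').
Proof.
move=> pq /ext_equivN/(ext_equivB pq).
by rewrite !opprK.
Qed.

Lemma ext_equiv_sym p q : ext_equiv p q -> ext_equiv q p.
Proof.
move/(ext_equivB (ext_equiv_refl (p + q))).
by rewrite addrK [p + q]addrC addrK.
Qed.

Lemma ext_equiv_trans q p r : ext_equiv p q -> ext_equiv q r -> ext_equiv p r.
Proof.
move=> pq qr; have := ext_equivB qr (ext_equivB (ext_equiv_refl q) pq).
by rewrite subrr subr0 opprB addrC subrK.
Qed.

Definition ext_rel : rel extdatum := fun p q => `[< ext_equiv p q >].

Fact ext_rel_is_equiv : equiv_class_of ext_rel.
Proof.
split=> [p|p q|q p r]; first exact/asboolP/ext_equiv_refl.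
  by apply/asboolP/asboolP; apply: ext_equiv_sym.
by move=> /asboolP pq /asboolP qr; apply/asboolP/(ext_equiv_trans pq qr).
Qed.
Canonical ext_rel_equiv := EquivRelPack ext_rel_is_equiv.
Canonical ext_rel_encModRel := defaultEncModRel ext_rel.

Definition Opext := {eq_quot ext_rel}.
HB.instance Definition _ : EqQuotient extdatum ext_rel Opext := EqQuotient.on Opext.
HB.instance Definition _ := Choice.on Opext.

Lemma Opext_eqP p q : reflect (ext_equiv p q) (\pi_Opext p == \pi_Opext q).
Proof. by rewrite piE; apply: asboolP. Qed.

Definition Opext_zero : Opext := lift_cst Opext 0.
Definition Opext_add := lift_op2 Opext +%R.
Definition Opext_opp := lift_op1 Opext -%R.

Canonical pi_Opext_zero_morph := PiConst Opext_zero.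

Fact pi_Opext_opp : {morph \pi : p / - p >-> Opext_opp p}.
Proof.
move=> p; unlock Opext_opp; apply/eqP/Opext_eqP/ext_equivN.
by apply/Opext_eqP; rewrite reprK.
Qed.
Canonical pi_Opext_opp_morph := PiMorph1 pi_Opext_opp.

Fact pi_Opext_add : {morph \pi : p q / p + q >-> Opext_add p q}.
Proof.
move=> p q /=; unlock Opext_add; apply/eqP/Opext_eqP.
by apply: ext_equivD; apply/Opext_eqP; rewrite reprK.
Qed.
Canonical pi_Opext_add_morph := PiMorph2 pi_Opext_add.

Fact Opext_addA : associative Opext_add.
Proof. by move=> p q r; rewrite -[p]reprK -[q]reprK -[r]reprK !piE addrA. Qed.
Fact Opext_addC : commutative Opext_add.
Proof. by move=> p q; rewrite -[p]reprK -[q]reprK !piE addrC. Qed.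
Fact Opext_add0 : left_id Opext_zero Opext_add.
Proof. by move=> p; rewrite -[p]reprK !piE add0r. Qed.
Fact Opext_addN : left_inverse Opext_zero Opext_opp Opext_add.
Proof. by move=> p; rewrite -[p]reprK !piE addNr. Qed.

(* The Baer product of extensions, written additively. *)
HB.instance Definition _ :=
  GRing.isZmodule.Build Opext Opext_addA Opext_addC Opext_add0 Opext_addN.

End OpextGroup.

(* Main.v *)
Require Import Defs.
From HB Require Import structures.
From mathcomp Require Import all_boot all_order all_algebra all_fingroup all_solvable.
From mathcomp Require Import boolp.

(** An extension datum (sigma, tau) assigns to each x in F a 2-cocycle
tau(-, -; x) of the abelian group V with values in k^*.  Its antisymmetrization
b_x(s, t) = tau(s, t; x) / tau(t, s; x) is an alternating bicharacter
([cocycle_alt_bilinear]), and since sigma enters the compatibility equation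
symmetrically in s and t, x |-> b_x is a derivation of F in the exterior square
of the dual of V.  A rescaling of the basis changes tau by coboundaries of V,
which are symmetric, so b depends on the class of the extension only.  As V has
odd order, b has a canonical square root, and (1, sqrt b) is again an extension
datum with antisymmetrization b: this splits Opext as a direct sum of the group
of derivations and of the classes whose tau is symmetric.

A symmetric cocycle of V is the cocycle of an abelian extension of V by k^*;
since every element of k^* is an n-th power, n being the exponent of V, the
extension splits ([symmetric_cocycle_split]).  So a class with tau symmetric
has a representative with tau = 1, and the compatibility equation then says
that s |-> sigma(s; x, y) is a character: sigma is a 2-cocycle of F in the dual
of V.  The rescalings which keep tau = 1 are the maps l(s, x) that are
characters in s, and they change sigma by coboundaries of F, which leaves
H^2(F, dual V) ([symmetric_extdatum], [datum_trivial]).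

The isomorphism is built backwards: [datum c d] is the extension datum
attached to a 2-cocycle c and a derivation d.  It is additive, it reaches every
class ([extdatum_decomposition]), and it is trivial exactly when c is a
coboundary and d = 0 ([datum_trivial]). *)

Set Implicit Arguments.
Unset Strict Implicit.
Unset Printing Implicit Defensive.

Import GRing.Theory.
Local Open Scope ring_scope.
Local Open Scope quotient_scope.

(** * Splitting of symmetric 2-cocycles *)

Section SymmetricCocycles.
Variables (U : zmodType) (V : finGroupType).

Record symcocycle := SymCocycle {
  sc_val :> V -> V -> U;
  sc1 : forall t, sc_val 1%g t = 0;
  scC : forall s t, sc_val s t = sc_val t s;
  scA : forall s t r,
    sc_val (s * t)%g r + sc_val s t = sc_val s (t * r)%g + sc_val t r }.

(** The abelian extension of V by U with cocycle T.  The commutativity of V is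
a parameter of the type so that its [zmodType] instance can find it. *)
Definition cext (abV : abelian [set: V]) (T : symcocycle) := (U * V)%type.

Variables (abV : abelian [set: V]) (T : symcocycle).
Local Notation E := (cext abV T).

Definition cext_add (p q : E) : E := (p.1 + q.1 + T p.2 q.2, (p.2 * q.2)%g).
Definition cext_opp (p : E) : E := (- p.1 - T (p.2)^-1%g p.2, (p.2)^-1%g).

Lemma abelianC (s t : V) : (s * t = t * s)%g.
Proof. by apply: (centsP abV); rewrite inE. Qed.

Fact cext_addA : associative cext_add.
Proof.
move=> [u s] [v t] [w r]; rewrite /cext_add /= mulgA; congr (_, _).
rewrite !addrA -[LHS]addrA (addrC (T t r)) -scA (addrAC _ (T s t) w).
by rewrite -[RHS]addrA (addrC (T s t)).
Qed.
Fact cext_addC : commutative cext_add.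
Proof. by move=> [u s] [v t]; rewrite /cext_add /= abelianC scC (addrC u). Qed.
Fact cext_add0 : left_id ((0, 1%g) : E) cext_add.
Proof. by move=> [u s]; rewrite /cext_add /= mul1g sc1 add0r addr0. Qed.
Fact cext_addN : left_inverse ((0, 1%g) : E) cext_opp cext_add.
Proof. by move=> [u s]; rewrite /cext_add /= mulVg [- u - _]addrC subrK addNr. Qed.

HB.instance Definition _ := Choice.on E.
HB.instance Definition _ :=
  GRing.isZmodule.Build E cext_addA cext_addC cext_add0 cext_addN.

Lemma cextD2 (p q : E) : (p + q).2 = (p.2 * q.2)%g. Proof. by []. Qed.
Lemma cextMn2 (p : E) i : (p *+ i).2 = (p.2 ^+ i)%g.
Proof. by elim: i => // i IH; rewrite mulrS cextD2 IH expgS. Qed.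
Lemma cext_kerMn u i : ((u, 1%g) : E) *+ i = (u *+ i, 1%g).
Proof.
elim: i => // i IH; rewrite !mulrS IH.
by rewrite /GRing.add /= /cext_add /= sc1 addr0 mulg1.
Qed.

Definition is_section (W : {set V}) (r : V -> E) : Prop :=
  {in W, forall s, (r s).2 = s} /\ {in W &, forall s t, r (s * t)%g = r s + r t}.

Hypothesis divU : forall u : U, exists v, v *+ exponent [set: V] = u.

Lemma divisible_dvdn m (u : U) :
  (m %| exponent [set: V])%N -> exists v, v *+ m = u.
Proof.
case/dvdnP=> q nE; have [v <-] := divU u.
by exists (v *+ q); rewrite -mulrnA nE.
Qed.

(** The order m of g modulo W divides the exponent of V, so a lift of g can be
divided by an m-th root of the discrepancy between its m-th power and the image
of g ^+ m under the section; the corrected lift e then extends the section by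
w * g ^+ i |-> r w + e *+ i. *)
Lemma section_extend (W : {group V}) g r :
  is_section W r -> exists r', is_section (W <*> <[g]>)%g r'.
Proof.
case=> r2 rD.
have nW x : x \in 'N(W)%g.
  by rewrite (subsetP (sub_abelian_norm abV (subsetT W))) ?inE.
set m := #[coset W g]%g.
have mP i : ((g ^+ i)%g \in W) = (m %| i)%N.
  rewrite order_dvdn -morphX //=; apply/idP/eqP => [/coset_id //|].
  exact: coset_idr.
have m_exp : (m %| exponent [set: V])%N.
  by rewrite order_dvdn -morphX //= expg_exponent ?inE // coset_id ?group1.
have r1 : r 1%g = 0.
  by apply: (addrI (r 1%g)); rewrite -rD ?group1 // mulg1 addr0.
have rX s q : s \in W -> r (s ^+ q)%g = r s *+ q.
  by move=> Ws; elim: q => // q IH; rewrite expgS rD ?groupX // IH mulrS.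
have [e e2 em] : exists2 e : E, e.2 = g & e *+ m = r (g ^+ m)%g.
  have Wgm : (g ^+ m)%g \in W by rewrite mP.
  pose e0 : E := (0, g).
  pose u := (e0 *+ m - r (g ^+ m)%g).1.
  have uE : e0 *+ m - r (g ^+ m)%g = (u, 1%g).
    rewrite [LHS]surjective_pairing; congr (_, _).
    by rewrite cextD2 cextMn2 /= r2 // mulgV.
  have [v vm] := divisible_dvdn u m_exp.
  exists (e0 - ((v, 1%g) : E)); first by rewrite cextD2 /= invg1 mulg1.
  by rewrite mulrnBl cext_kerMn vm -uE subKr.
(* The corrected lift makes the extended section well defined. *)
have wd w w' i j : w \in W -> w' \in W ->
    (w * g ^+ i = w' * g ^+ j)%g -> r w + e *+ i = r w' + e *+ j.
  wlog le_ji : w w' i j / (j <= i)%N.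
    move=> IH Ww Ww' Ewij; have [/IH|/ltnW/IH] := leqP j i; first exact.
    by move=> {}IH; apply/esym/IH.
  move=> Ww Ww'; rewrite -(subnK le_ji) expgD mulgA => /mulIg Ew.
  have : (g ^+ (i - j))%g \in W by rewrite -(groupMl _ Ww) Ew.
  rewrite mP => /dvdnP[q qE].
  by rewrite -Ew rD ?mP ?qE ?dvdn_mull // mulnC expgM rX ?mP // -em -mulrnA mulrnDr addrA.
have /choice[r' r'P] x : exists y, forall w i, w \in W -> (w * g ^+ i)%g = x -> y = r w + e *+ i.
  have [[w [i [Ww <-]]]|no] := pselect (exists w i, w \in W /\ (w * g ^+ i)%g = x).
    by exists (r w + e *+ i) => w' i' Ww' /esym; apply: wd.
  by exists 0 => w i Ww wix; case: no; exists w, i.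
exists r'.
have r'E w i : w \in W -> r' (w * g ^+ i)%g = r w + e *+ i by move=> Ww; apply: r'P.
have WgP x : x \in (W <*> <[g]>)%g -> exists w i, w \in W /\ x = (w * g ^+ i)%g.
  rewrite norm_joinEr ?cycle_subG //.
  by case/mulsgP=> w _ Ww /cycleP[i ->] ->; exists w, i.
split=> [x /WgP[w [i [Ww ->]]]|x y /WgP[w [i [Ww ->]]] /WgP[w' [i' [Ww' ->]]]].
  by rewrite r'E // cextD2 cextMn2 r2 // e2.
have -> : (w * g ^+ i * (w' * g ^+ i') = w * w' * g ^+ (i + i'))%g.
  by rewrite expgD !mulgA -(mulgA w) (abelianC _ w') mulgA.
by rewrite !r'E ?groupM // rD // mulrnDr addrACA.
Qed.

Lemma section_exists : exists r, is_section [set: V] r.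
Proof.
suff [r rP] : exists r, is_section <<[set x in enum V]>>%g r.
  by exists r; split=> [s _|s t _ _]; apply rP; rewrite mem_gen // inE mem_enum.
elim: (enum V) => [|g S [r rP]].
  exists (fun _ => 0); rewrite (_ : [set x in [::]] = set0); last by apply/setP => x; rewrite !inE.
  by rewrite gen0; split=> [s|s t]; rewrite ?inE ?addr0 // => /eqP.
have [r' r'P] := section_extend g rP; exists r'.
suff -> : [set x in g :: S] = [set x in S] :|: [set g].
  by move: r'P; rewrite /= joing_idl joing_idr.
by apply/setP => x; rewrite !inE orbC.
Qed.

End SymmetricCocycles.

(** A homomorphic section of the extension defined by T is a map of the form
s |-> (l s, s), and being a homomorphism says that T is the coboundary of l.
Sections extend from a subgroup to a larger one by one generator at a time. *)
Lemma symmetric_cocycle_split (U : zmodType) (V : finGroupType) (T : symcocycle U V) :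
  abelian [set: V] -> (forall u : U, exists v, v *+ exponent [set: V] = u) ->
  exists l : V -> U, forall s t, T s t = l (s * t)%g - l s - l t.
Proof.
move=> abV divU; have [r [r2 rD]] := section_exists abV T divU.
exists (fun s => (r s).1) => s t; rewrite rD ?inE //= !r2 ?inE //.
by rewrite -[RHS]addrA -opprD addrAC subrr add0r.
Qed.

(** The function on the left is the commutator pairing of the central extension
defined by T.  The three instances of the cocycle equation used are those for
(s, t, r), (r, s, t) and (s, r, t). *)
Lemma cocycle_alt_bilinear (U : zmodType) (V : finGroupType) (T : V -> V -> U) :
  abelian [set: V] ->
  (forall s t r, T (s * t)%g r + T s t = T s (t * r)%g + T t r) ->
  forall s t r, T (s * t)%g r - T r (s * t)%g = T s r - T r s + (T t r - T r t).
Proof.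
move=> abV TA s t r.
have -> : T (s * t)%g r = T s (t * r)%g + T t r - T s t by rewrite -TA addrK.
have -> : T r (s * t)%g = T (r * s)%g t + T r s - T s t by rewrite TA addrK.
have -> : T s (t * r)%g = T (r * s)%g t + T s r - T r t.
  by rewrite (abelianC abV t) (abelianC abV r s) TA addrK.
rewrite opprB addrA subrK -!(addrA (T (r * s)%g t)) opprD addrACA.
by rewrite addrA (addrC (T (r * s)%g t)) subrK addrACA (addrC (- T r t)) addrACA.
Qed.

(** * Evaluating characters and alternating bicharacters *)

Section Evaluation.
Variables (k : fieldType) (F V : finGroupType).
Variable act : groupAction [set: F] [set: V].

Lemma charM (c : dual k V) s t : c (s * t)%g = c s + c t.
Proof. exact: (asboolW (dualP c)). Qed.

Lemma ext2P' (b : ext2dual k V) : is_altbichar b.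
Proof. exact: (asboolW (ext2P b)). Qed.

Lemma ext2_alt (b : ext2dual k V) s t : b (t, s) = - b (s, t).
Proof.
have [bl br bb] := ext2P' b; apply/eqP; rewrite -addr_eq0 addrC.
by have := bb (s * t)%g; rewrite bl !br !bb add0r addr0 => ->.
Qed.

Lemma ext2D (b c : ext2dual k V) s t : (b + c) (s, t) = b (s, t) + c (s, t).
Proof. by rewrite ffunE. Qed.

Lemma ext2Mn (b : ext2dual k V) n s t : (b *+ n) (s, t) = b (s, t) *+ n.
Proof.
by elim: n => [|n IH]; rewrite ?mulr0n ?mulrS !ffunE // IH.
Qed.

Lemma ext2X (b : ext2dual k V) n s t : b ((s ^+ n)%g, t) = b (s, t) *+ n.
Proof.
have [bl br bb] := ext2P' b; elim: n => [|n IH]; last by rewrite expgS bl IH mulrS.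
by apply: (addrI (b (1%g, t))); rewrite -bl mulg1 addr0.
Qed.

Lemma ext2_1l (b : ext2dual k V) t : b (1%g, t) = 0.
Proof. exact: (ext2X b 0 1%g t). Qed.

(** The square root of b: multiplication by (|V| + 1) / 2 inverts 2 on a group
killed by the odd number |V|. *)
Definition ext2_half (b : ext2dual k V) := b *+ (#|[set: V]|.+1)./2.

Lemma ext2_halfK (b : ext2dual k V) :
  odd #|[set: V]| -> ext2_half b + ext2_half b = b.
Proof.
move=> oddV; rewrite -mulrnDr addnn halfK /= oddV subn0 mulrS.
rewrite [X in _ + X](_ : _ = 0) ?addr0 //; apply/val_inj/ffunP => -[s t].
by rewrite ext2Mn -ext2X expg_cardG ?inE // ext2_1l ffunE.
Qed.

(** * Evaluating derivations and 2-cocycles *)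

Lemma derE (d : Der (ext2_gmod k act)) x y s t :
  d (x * y)%g (s, t) = d x (s, t) + d y (act s x, act t x).
Proof. by case: d => d /= /asboolP ->; rewrite !ffunE. Qed.

Lemma cocycleE (c : cocycle2 (dual_gmod k act)) x y z s :
  c (y, z) (act s x) + c (x, (y * z)%g) s = c ((x * y)%g, z) s + c (x, y) s.
Proof.
case: c => c /= /asboolP /(_ x y z) /(congr1 (fun f : dual k V => f s)).
by rewrite !ffunE.
Qed.

Lemma cocycle1l (c : cocycle2 (dual_gmod k act)) y s :
  c (1%g, y) s = c (1%g, 1%g) s.
Proof.
by have := cocycleE c 1%g 1%g y s; rewrite !mul1g ract1 => /addrI.
Qed.

Lemma cocycle1r (c : cocycle2 (dual_gmod k act)) x s :
  c (x, 1%g) s = c (1%g, 1%g) (act s x).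
Proof.
by have := cocycleE c x 1%g 1%g s; rewrite !mulg1 [RHS]addrC => /addIr.
Qed.

(** * The extension datum of a cocycle and a derivation *)

(** Cocycles of F are not assumed to be normalized, whereas sigma has to be.
The coboundary of the constant map c(1, 1) is (x, y) |-> x . c(1, 1), and it
agrees with c as soon as x or y is 1 (see [cocycle1l] and [cocycle1r]). *)
Definition normalized (c : cocycle2 (dual_gmod k act)) s x y : kunits k :=
  c (x, y) s - c (1%g, 1%g) (act s x).

Lemma normalizedM c s t x y :
  normalized c (s * t)%g x y = normalized c s x y + normalized c t x y.
Proof. by rewrite /normalized ract_morph !charM opprD addrACA. Qed.

Lemma normalizedE c s x y z :
  normalized c (act s x) y z + normalized c s x (y * z)%g =
  normalized c s x y + normalized c s (x * y)%g z.
Proof.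
rewrite /normalized addrACA cocycleE -ractM -!opprD.
by rewrite [RHS]addrACA -opprD (addrC (c (x, y) s)) (addrC (c _ (act s x))).
Qed.

Definition datum_val (c : cocycle2 (dual_gmod k act)) (d : Der (ext2_gmod k act)) :
    extpairs k F V :=
  ([ffun a => normalized c a.1.1 a.1.2 a.2],
   [ffun a => ext2_half (d a.2) (a.1.1, a.1.2)]).

Fact datum_subproof c d : datum_val c d \in extdatum_pred act.
Proof.
apply/asboolP; split=> [s x|s x|s x|s x|s x y z|s t r x|s t x y]; rewrite !ffunE /=.
- by rewrite /normalized cocycle1l ract1 subrr.
- by rewrite /normalized cocycle1r subrr.
- by rewrite ext2_1l.
- by rewrite ext2_alt ext2_1l oppr0.
- exact: normalizedE.
- by have [bl br _] := ext2P' (ext2_half (d x)); rewrite bl br addrC addrA.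
- by rewrite normalizedM !ext2Mn derE mulrnDl addrA.
Qed.
Definition datum c d : extdatum k act := Extdatum (datum_subproof c d).

Lemma datumB c d c' d' : datum (c - c') (d - d') = datum c d - datum c' d'.
Proof.
apply/val_inj; congr (_, _); apply/ffunP => -[[a b] e]; rewrite !ffunE /=.
  by rewrite /normalized !ffunE /= !opprD addrACA.
by rewrite !ext2Mn !ffunE /= mulrnBl.
Qed.

Lemma ext_equiv0B (p q : extdatum k act) : ext_equiv (p - q) 0 <-> ext_equiv p q.
Proof.
split=> [pq|pq]; last by have := ext_equivB pq (ext_equiv_refl q); rewrite subrr.
by have := ext_equivD pq (ext_equiv_refl q); rewrite subrK add0r.
Qed.

(** Compares a cochain h whose coboundary is c with the normalized cochain
h - c(1, 1), whose coboundary is the normalization of c. *)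
Lemma coboundary_shiftE (U : zmodType) (p q r m n c : U) :
  p - m + (q - n) = r - m + (c - n) <-> c = q - r + p.
Proof.
rewrite [LHS in LHS = _]addrACA [RHS in _ = RHS]addrACA.
split=> [/addIr E|->]; first by rewrite addrAC [q + p]addrC E addrAC subrr add0r.
by rewrite [q - r + p]addrAC [r + _]addrC subrK (addrC q).
Qed.

Lemma char_coboundary (c : cocycle2 (dual_gmod k act)) (h : {ffun F -> dual k V}) :
  (forall x y, c (x, y) = dual_act act x (h y) - h (x * y)%g + h x) <->
  forall s x y, c (x, y) s = h y (act s x) - h (x * y)%g s + h x s.
Proof.
split=> hP; first by move=> s x y; rewrite hP !ffunE.
by move=> x y; apply/val_inj/ffunP => s; rewrite /= hP !ffunE.
Qed.

(** In a rescaling of [datum c d] to the trivial datum, antisymmetrizing the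
equation for tau kills the symmetric coboundary of l and leaves d = 0; then l is
a character in its first argument, that is, a cochain of F in the dual of V
whose coboundary is the normalization of c. *)
Lemma datum_trivial c d : abelian [set: V] -> odd #|[set: V]| ->
  ext_equiv (datum c d) 0 <-> is_coboundary2 c /\ d = 0.
Proof.
move=> abV oddV; split=> [/ext_equivP[l [ls lt]]|[[h /char_coboundary hP] ->]]; last first.
  apply/ext_equivP; exists [ffun a => (h a.2 - c (1%g, 1%g)) a.1].
  split=> [s x y|s t x]; rewrite !ffunE /=; last first.
    by rewrite ext2Mn !ffunE mul0rn !addr0 !charM opprD addrACA.
  by rewrite addr0; apply/coboundary_shiftE.
have d0 : d = 0.
  apply/val_inj/ffunP => x; apply/val_inj/ffunP => -[s t].
  have := lt s t x; have := lt t s x; rewrite (abelianC abV t) !ffunE /= => ->.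
  rewrite (addrC (l (t, x))) => /addrI/esym; rewrite (ext2_alt _ s t) => /eqP; rewrite -addr_eq0 => /eqP E.
  by rewrite -[d x](ext2_halfK _ oddV) ext2D E.
have lM x : [ffun s => l (s, x)] \in @char_pred k V.
  apply/asboolP => s t; rewrite !ffunE.
  by have := lt s t x; rewrite !ffunE d0 ext2Mn !ffunE mul0rn !addr0.
split=> //; exists [ffun x => Dual (lM x) + c (1%g, 1%g)].
apply/char_coboundary => s x y; rewrite !ffunE /=.
apply/(coboundary_shiftE _ _ _ (c (1%g, 1%g) s) (c (1%g, 1%g) (act s x))).
by have := ls s x y; rewrite !ffunE addr0 !addrK.
Qed.

(** * Every extension datum comes from a cocycle and a derivation *)

(** The cancellation behind the fact that the coboundary of a 1-cochain of F is
a 2-cocycle. *)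
Lemma coboundary_cocycle (U : zmodType) (a b c e f g : U) :
  (a - b + c) + (b - e + f) = (a - e + g) + (c - g + f).
Proof.
rewrite (addrAC a) -(addrA b) [LHS]addrA subrK [RHS]addrC (addrAC c) (addrC _ g).
by rewrite [RHS]addrA subrK [RHS]addrC addrACA.
Qed.

(** When tau is a coboundary of V, its part in the compatibility equation can be
absorbed in sigma. *)
Lemma compat_shift (U : zmodType) (A S B b C c D d : U) :
  A + (B - b) = S + (C - c) + (D - d) -> A - (D - B + C) = S - (d - b + c).
Proof.
move=> E; apply/eqP; rewrite subr_eq -(addrK (B - b) A) E !opprD !opprK !addrA.
by apply/eqP; rewrite [LHS](ACl (1*5*7*3*4*6*2)).
Qed.

(** Two compatibility equations that have the same part S, R coming from sigma:
it cancels in their difference. *)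
Lemma compat_alt (U : zmodType) (A A' S R P Q P' Q' : U) :
  S + A = R + P + Q -> S + A' = R + P' + Q' -> A - A' = (P - P') + (Q - Q').
Proof.
move=> E E'; have -> : A - A' = S + A - (S + A').
  by rewrite opprD addrACA subrr add0r.
by rewrite E E' -(addrA R P) -(addrA R P') opprD addrACA subrr add0r opprD addrACA.
Qed.

(** For each x, tau(-, -; x) is the coboundary of some l_x by the splitting of
symmetric cocycles.  Rescaling by l removes tau, and sigma becomes a cocycle
of F with values in characters of V. *)
Lemma symmetric_extdatum (p : extdatum k act) :
  abelian [set: V] ->
  (forall u : kunits k, exists v, v *+ exponent [set: V] = u) ->
  (forall s t x, (extd_val p).2 (s, t, x) = (extd_val p).2 (t, s, x)) ->
  exists c, ext_equiv p (datum c 0).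
Proof.
move=> abV divk; have pP := extdP2 p.
set sg := (extd_val p).1 in pP *; set tu := (extd_val p).2 in pP * => tauC.
have tau1 s t : tu (s, t, 1%g) = 0.
  have := extd_compat pP s t 1%g 1%g; rewrite /= mulg1 !ract1 !(extd_sigma1 pP) !add0r.
  by rewrite -[LHS]addr0 => /addrI.
(* As tau(-, -; 1) = 0, the trivial choice of l_1 is possible; it makes the
   rescaled sigma normalized. *)
have /choice[l lP] x : exists l : V -> kunits k,
    (forall s t, tu (s, t, x) = l (s * t)%g - l s - l t) /\ (x = 1%g -> forall s, l s = 0).
  have [->|x1] := eqVneq x 1%g.
    by exists (fun _ => 0); split=> // s t; rewrite tau1 !subr0.
  have tu1 t : tu (1%g, t, x) = 0 by exact: extd_tau1 pP t x.
  have tuA s t r : tu ((s * t)%g, r, x) + tu (s, t, x) = tu (s, (t * r)%g, x) + tu (t, r, x).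
    exact: extd_tau pP s t r x.
  pose T := @SymCocycle _ _ (fun s t => tu (s, t, x)) tu1 (fun s t => tauC s t x) tuA.
  have [l lP] := symmetric_cocycle_split T abV divk.
  by exists l; split=> // xE; rewrite xE eqxx in x1.
have l1 s : l 1%g s = 0 by have [_ ->] := lP 1%g.
pose b s x y := l y (act s x) - l (x * y)%g s + l x s.
have bE s x y z : b (act s x) y z + b s x (y * z)%g = b s (x * y)%g z + b s x y.
  by rewrite /b ractM mulgA; apply: coboundary_cocycle.
have cM x y : [ffun s => sg (s, x, y) - b s x y] \in @char_pred k V.
  apply/asboolP => s t; rewrite !ffunE addrACA -opprD.
  have -> : b s x y + b t x y = (l y (act s x) + l y (act t x)) -
      (l (x * y)%g s + l (x * y)%g t) + (l x s + l x t).
    by rewrite /b addrACA (addrACA (l y _)) -opprD.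
  have tuE z s' t' : l z (s' * t')%g - (l z s' + l z t') = tu (s', t', z).
    by have [-> _] := lP z; rewrite opprD addrA.
  by apply: compat_shift; rewrite ract_morph !tuE; apply: extd_compat pP _ _ _ _.
have cP : [ffun a => Dual (cM a.1 a.2)] \in cocycle2_pred (dual_gmod k act).
  apply/asboolP => x y z; apply/val_inj/ffunP => s; rewrite !ffunE /=.
  rewrite addrACA [RHS]addrACA -!opprD bE.
  by rewrite (extd_sigma pP s x y z) (addrC (sg _)).
pose c : cocycle2 (dual_gmod k act) := Cocycle2 cP.
have cE s x y : normalized c s x y = sg (s, x, y) - b s x y.
  rewrite /normalized !ffunE /= (extd_sigma1 pP) /b mulg1.
  by rewrite !l1 !(subr0, addr0).
exists c; apply/ext_equivP; exists [ffun a => l a.2 a.1].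
split=> [s x y|s t x]; rewrite !ffunE /=.
  rewrite cE /b (addrAC (l y _)) (addrC (l y _)) opprB [X in _ + X]addrA [LHS]addrC.
  by rewrite subrK addrC.
have [-> _] := lP x; rewrite ext2Mn !ffunE mul0rn addr0.
by rewrite -[X in _ = _ + X]addrA -opprD [RHS]addrC subrK.
Qed.

(** Dividing tau by the square root of its antisymmetrization leaves a symmetric
cocycle. *)
Lemma extdatum_decomposition (p : extdatum k act) :
  abelian [set: V] -> odd #|[set: V]| ->
  (forall u : kunits k, exists v, v *+ exponent [set: V] = u) ->
  exists c d, ext_equiv p (datum c d).
Proof.
move=> abV oddV divk; have pP := extdP2 p.
pose tau s t x := (extd_val p).2 (s, t, x).
pose alt x : {ffun V * V -> kunits k} := [ffun a => tau a.1 a.2 x - tau a.2 a.1 x].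
have altP x : alt x \in @altbichar_pred k V.
  have altM s t r : alt x (s * t, r)%g = alt x (s, r) + alt x (t, r).
    rewrite !ffunE /=.
    by apply: (@cocycle_alt_bilinear _ _ (fun s t => tau s t x)) => // *; apply: extd_tau pP _ _ _ _.
  have altN s t : alt x (t, s) = - alt x (s, t) by rewrite !ffunE opprB.
  apply/asboolP; split=> [//|s t r|s]; last by rewrite ffunE subrr.
  by rewrite altN altM opprD -!altN.
have dP : [ffun x => Ext2Dual (altP x)] \in der_pred (ext2_gmod k act).
  apply/asboolP => x y; apply/val_inj/ffunP => -[s t]; rewrite !ffunE /=.
  have := extd_compat pP t s x y; rewrite (abelianC abV t s) (addrC ((extd_val p).1 (t, x, y))).
  exact: compat_alt (extd_compat pP s t x y).
have [d dE] : exists d : Der (ext2_gmod k act), forall x s t,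
    ext2_half (d x) (s, t) + ext2_half (d x) (s, t) = tau s t x - tau t s x.
  by exists (MkDer dP) => x s t; rewrite -ext2D ext2_halfK // !ffunE.
have [s t x|c pc] := @symmetric_extdatum (p - datum 0 d) abV divk.
  rewrite !ffunE /= (ext2_alt _ s t).
  by apply/eqP; rewrite subr_eq opprK -addrA dE addrC subrK.
exists c, d; rewrite -[p](subrK (datum 0 d)).
have -> : datum c d = datum c 0 + datum 0 d.
  by apply/eqP; rewrite -subr_eq -datumB subr0 subrr.
exact: ext_equivD pc (ext_equiv_refl _).
Qed.

Lemma Opext_datum_eq c c' d d' : abelian [set: V] -> odd #|[set: V]| ->
  \pi_(Opext k act) (datum c d) = \pi_(Opext k act) (datum c' d') <->
  (\pi_(H2 (dual_gmod k act)) c, d) = (\pi_(H2 (dual_gmod k act)) c', d').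
Proof.
move=> abV oddV; split.
  move/eqP/Opext_eqP/ext_equiv0B; rewrite -datumB.
  case/(datum_trivial _ _ abV oddV) => cob /subr0_eq ->.
  by congr (_, _); apply/eqP; rewrite -Quotient.idealrBE; apply/asboolP.
case=> /eqP; rewrite -Quotient.idealrBE => /asboolP cob ->.
by apply/eqP/Opext_eqP/ext_equiv0B; rewrite -datumB subrr; apply/datum_trivial.
Qed.

Lemma pi_OpextB (p q : extdatum k act) :
  \pi_(Opext k act) (p - q) = \pi_(Opext k act) p - \pi_(Opext k act) q.
Proof. by rewrite pi_Opext_add pi_Opext_opp. Qed.

End Evaluation.

Lemma pi_H2B (F : finGroupType) (M : zmodType) (A : gmodule F M) (c c' : cocycle2 A) :
  \pi_(H2 A) (c - c') = \pi_(H2 A) c - \pi_(H2 A) c'.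
Proof. by rewrite Quotient.pi_add Quotient.pi_opp. Qed.

Lemma kvalMn (k : fieldType) (a : kunits k) n : kval (a *+ n) = kval a ^+ n.
Proof. by elim: n => // n IH; rewrite mulrS kvalD IH exprS. Qed.

Theorem theorem5p3 (k : fieldType) (F V : finGroupType)
    (act : groupAction [set: F] [set: V]) :
  abelian [set: V] ->
  odd #|[set: V]| ->
  (forall a : k, a != 0 -> exists2 b : k, b != 0 & b ^+ exponent [set: V] = a) ->
  exists f : {additive Opext k act -> (H2 (dual_gmod k act) * Der (ext2_gmod k act))%type},
    bijective f.
Proof.
move=> abV oddV rootk.
have divk (u : kunits k) : exists v, v *+ exponent [set: V] = u.
  have [b b0 bu] := rootk u (kvalP u).
  by exists (KUnit b0); apply/val_inj; rewrite /= kvalMn.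
pose HD := (H2 (dual_gmod k act) * Der (ext2_gmod k act))%type.
pose g (a : HD) := \pi_(Opext k act) (datum (generic_quotient.repr a.1) a.2).
have gB : zmod_morphism g.
  move=> a b; rewrite /g -pi_OpextB -datumB; apply/Opext_datum_eq => //.
  by rewrite pi_H2B !reprK.
have g_inj : injective g.
  by move=> [h d] [h' d'] /(Opext_datum_eq _ _ _ _ abV oddV); rewrite !reprK.
have g_surj q : exists a, g a = q.
  have [c [d /Opext_eqP/eqP pE]] :=
    extdatum_decomposition (generic_quotient.repr q) abV oddV divk.
  exists (\pi_(H2 (dual_gmod k act)) c, d); rewrite -[RHS]reprK pE.
  by apply/Opext_datum_eq; rewrite ?reprK.
have /choice[f fK] := g_surj.
have gK : cancel g f by move=> a; apply: g_inj; rewrite fK.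
pose gadd : {additive HD -> Opext k act} :=
  HB.pack g (GRing.isZmodMorphism.Build _ _ g gB).
have fB : zmod_morphism f by exact: (@can2_zmod_morphism _ _ gadd).
exists (HB.pack f (GRing.isZmodMorphism.Build _ _ f fB) : {additive Opext k act -> HD}).
by exists g.
Qed.
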